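(* Let $C$ be a multi-rotationally symmetric planar convex body, with maximal degree $k_C$ and minimal degree $\chi_C\geq 3$. Let $\{k_1=\chi_C,\ldots,k_n=k_C\}$ be the set of divisors of $k_C$ greater than $1$, with $k_1<\ldots<k_n$. Then $$d_M(P_{k_1})\geq\ldots\geq d_M(P_{k_n}),$$ where $P_k$ denotes the standard $k$-partition associated to $C$.
   Context: A planar convex body is a compact convex subset of $\mathbb{R}^2$ with non-empty interior. For $k\in\mathbb{N}$, $k\geq 2$, a planar convex body $C$ is $k$-rotationally symmetric if there is a point $p\in C$ (the center of symmetry of $C$) such that $C$ is invariant under the rotation of angle $2\pi/k$ about $p$. $C$ is multi-rotationally symmetric if it is $k$-rotationally symmetric for more than one value of $k$. The minimal degree $\chi_C$ is the smallest $k\geq 2$ for which $C$ is $k$-rotationally symmetric; if $C$ is not a circle (i.e. a disk), the maximal degree $k_C$ is the largest such $k$. (A circle has minimal degree $2$.) $C$ is $k$-rotationally symmetric exactly when $k$ is a divisor of $k_C$ greater than $1$. Standard $k$-partition: let $C$ be $k$-rotationally symmetric with center of symmetry $p$. Let $x_1,\ldots,x_k$ be points of $\partial C$ at minimal distance to $p$, symmetrically placed along $\partial C$ (they are the images of one such point under the rotations about $p$ of angles that are multiples of $2\pi/k$). The line segments $\overline{p\,x_i}$ divide $C$ into $k$ connected congruent (closed) subsets $C_1,\ldots,C_k$; this decomposition is the standard $k$-partition $P_k$ associated to $C$. The maximum relative diameter of a decomposition $P$ of $C$ into subsets $C_1,\ldots,C_k$ is $d_M(P)=\max\{D(C_i):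 i=1,\ldots,k\}$, where $D(C_i)=\max\{d(x,y):x,y\in C_i\}$ is the Euclidean diameter. *)

(* Defs.v *)
From HB Require Import structures.
From mathcomp Require Import all_boot all_order all_algebra.
From mathcomp Require Import all_classical all_reals all_analysis.

Set Implicit Arguments.
Unset Strict Implicit.
Unset Printing Implicit Defensive.

Import Order.TTheory GRing.Theory Num.Theory.
Import numFieldNormedType.Exports.

Local Open Scope classical_set_scope.
Local Open Scope ring_scope.

(* The plane is R * R.  Its library norm is the sup norm, which induces the
   usual topology but not the Euclidean distance, hence [eucl_dist]. *)
Definition eucl_dist (R : realType) (x y : R * R) : R :=
  Num.sqrt ((x.1 - y.1) ^+ 2 + (x.2 - y.2) ^+ 2).

(* [sup] is the maximum for a compact nonempty set. *)
Definition diameter (R : realType) (A : set (R * R)) : R :=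
  sup [set d | exists x y, [/\ A x, A y & d = eucl_dist x y]].

Definition rotation (R : realType) (p : R * R) (theta : R) (x : R * R) : R * R :=
  (p.1 + cos theta * (x.1 - p.1) - sin theta * (x.2 - p.2),
   p.2 + sin theta * (x.1 - p.1) + cos theta * (x.2 - p.2)).

Definition segment (R : realType) (x y : R * R) : set (R * R) :=
  [set z | exists t : R, 0 <= t <= 1 /\ z = x + t *: (y - x)].

Definition boundary (R : realType) (C : set (R * R)) : set (R * R) :=
  closure C `\` interior C.

Definition planar_convex_body (R : realType) (C : set (R * R)) : Prop :=
  [/\ compact C, convex_set C & interior C !=set0].

Definition center_of_symmetry (R : realType) (C : set (R * R)) (k : nat)
    (p : R * R) : Prop :=
  C p /\ rotation p (2 * pi / k%:R) @` C = C.

Definition rot_symmetric (R : realType) (C : set (R * R)) (k : nat) : Prop :=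
  (2 <= k)%N /\ exists p, center_of_symmetry C k p.

Definition multi_rot_symmetric (R : realType) (C : set (R * R)) : Prop :=
  exists k l, [/\ rot_symmetric C k, rot_symmetric C l & k <> l].

Definition minimal_degree (R : realType) (C : set (R * R)) (k : nat) : Prop :=
  rot_symmetric C k /\ forall l, rot_symmetric C l -> (k <= l)%N.

(* A disk is rotationally symmetric of every order, so it has no maximal
   degree in this sense. *)
Definition maximal_degree (R : realType) (C : set (R * R)) (k : nat) : Prop :=
  rot_symmetric C k /\ forall l, rot_symmetric C l -> (l <= k)%N.

Definition nearest_boundary_point (R : realType) (C : set (R * R))
    (p x : R * R) : Prop :=
  boundary C x /\
  forall y, boundary C y -> eucl_dist p x <= eucl_dist p y.

(* The k segments joining p to the images of x under the rotations about p of
   angles 2 pi i / k. *)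
Definition spokes (R : realType) (k : nat) (p x : R * R) : set (R * R) :=
  \bigcup_(i < k) segment p (rotation p (2 * pi * i%:R / k%:R) x).

(* A decomposition is the set of its pieces.  The pieces cut out by a set S
   are the closures of the connected components of the rest of C. *)
Definition pieces (R : realType) (C S : set (R * R)) : set (set (R * R)) :=
  [set closure (connected_component (C `\` S) y) | y in C `\` S].

(* A relation, since the nearest boundary point x need not be unique. *)
Definition standard_partition (R : realType) (C : set (R * R)) (k : nat)
    (P : set (set (R * R))) : Prop :=
  (2 <= k)%N /\
  exists p x, [/\ center_of_symmetry C k p, nearest_boundary_point C p x &
                  P = pieces C (spokes k p x)].

Definition max_rel_diameter (R : realType) (P : set (set (R * R))) : R :=
  sup [set diameter A | A in P].

(* Main.v *)
Require Import Defs.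
From mathcomp Require Import all_boot all_order all_algebra.
From mathcomp Require Import all_classical all_reals all_analysis.
From mathcomp Require Import ring lra zify.

Set Implicit Arguments.
Unset Strict Implicit.
Unset Printing Implicit Defensive.

Import Order.TTheory GRing.Theory Num.Theory.
Import numFieldNormedType.Exports.

Local Open Scope classical_set_scope.
Local Open Scope ring_scope.

(** Let r be the distance from the center p to the boundary.  The claim follows
    from two opposite estimates for the maximum relative diameter d_k of the
    standard k-partition.

    From below, p belongs to every piece, so d_k is at least the
    distance from p to any point of C ([center_dist_le]).  Moreover two
    consecutive endpoints of the spokes for k = 3 lie in a common piece, so
    d_3 >= r sqrt 3 ([triangle_dist_le]).

    From above, each piece of the l-partition lies in a closed angular sector
    of opening 2 pi / l at p ([piece_in_sector]).  If l >= 6 the opening is at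
    most pi / 3, and two points of such a sector are never farther apart than
    the farther of them is from p ([narrow_sector_dist]); that distance is
    bounded by every d_k.  If l = 5, the tangents to the disk of radius r at
    the ends of the two bounding spokes confine the piece to a small kite of
    diameter at most r sqrt 3 ([truncated_sector_dist]), and this is at most
    d_3.

    These two cases are enough: a minimal degree of at least 3 makes every
    divisor in the list odd, so that k < l leaves only l >= 6 or
    (k, l) = (3, 5).  The comparison needs one center for all degrees
    ([center_unique]), lying inside C ([center_interior]), and a point of C off
    all the spokes; the latter exists because C is not a disk ([far_point]), a
    disk having minimal degree 2. *)

(** * Rotations of plane vectors *)

Definition dot {R : realType} (u v : R * R) : R := u.1 * v.1 + u.2 * v.2.

Definition cross {R : realType} (u v : R * R) : R := u.1 * v.2 - u.2 * v.1.

Definition rot {R : realType} (t : R) (u : R * R) : R * R :=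
  (cos t * u.1 - sin t * u.2, sin t * u.1 + cos t * u.2).

(** The index j ranges over all natural numbers and has period k, so that the
    neighbor of j is always j.+1, without a wrap-around case. *)
Definition spoke {R : realType} (k : nat) (u : R * R) (j : nat) : R * R :=
  rot (2 * pi * j%:R / k%:R) u.

Lemma vec_eq (R : realType) (u v : R * R) : u.1 = v.1 -> u.2 = v.2 -> u = v.
Proof. by case: u v => [u1 u2] [v1 v2] /= -> ->. Qed.

Lemma eucl_distE (R : realType) (x y : R * R) :
  eucl_dist x y = Num.sqrt (dot (x - y) (x - y)).
Proof. by rewrite /eucl_dist /dot /= !expr2. Qed.

Lemma eucl_distC (R : realType) (x y : R * R) : eucl_dist x y = eucl_dist y x.
Proof. by rewrite !eucl_distE /dot /=; congr Num.sqrt; ring. Qed.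

Lemma dotZZ (R : realType) (t : R) (u : R * R) :
  dot (t *: u) (t *: u) = t ^+ 2 * dot u u.
Proof. by rewrite /dot /= /GRing.scale/=; ring. Qed.

Lemma dotBB (R : realType) (a b : R * R) :
  dot (a - b) (a - b) = dot a a + dot b b - 2 * dot a b.
Proof. by rewrite /dot /=; ring. Qed.

Lemma dotC (R : realType) (u v : R * R) : dot u v = dot v u.
Proof. by rewrite /dot; ring. Qed.

Lemma dot_linl (R : realType) (a b v : R * R) (x y : R) :
  dot (x *: a + y *: b) v = x * dot a v + y * dot b v.
Proof. by rewrite /dot /= /GRing.scale/=; ring. Qed.

Lemma dot_ge0 (R : realType) (u : R * R) : 0 <= dot u u.
Proof. by rewrite /dot -!expr2 addr_ge0 ?sqr_ge0. Qed.

Lemma dot_gt0 (R : realType) (u : R * R) : u != 0 -> 0 < dot u u.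
Proof.
case: u => a b ab0; rewrite lt0r dot_ge0 andbT; apply: contra ab0.
rewrite /dot /= -!expr2 paddr_eq0 ?sqr_ge0// !sqrf_eq0.
by move=> /andP[/eqP-> /eqP->].
Qed.

Lemma rotationE (R : realType) (p x : R * R) (t : R) :
  rotation p t x = p + rot t (x - p).
Proof. by rewrite /rotation /rot; congr pair; rewrite /= ?addrA. Qed.

Lemma rotD (R : realType) (s t : R) (u : R * R) :
  rot s (rot t u) = rot (s + t) u.
Proof. by rewrite /rot/= cosD sinD; congr pair; ring. Qed.

Lemma rot_sum (R : realType) (I : finType) (t : R) (f : I -> R * R) :
  rot t (\sum_i f i) = \sum_i rot t (f i).
Proof.
apply: (big_morph (rot t)) => [u v|]; rewrite /rot /=; congr pair => /=; ring.
Qed.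

Lemma dot_rot (R : realType) (s t : R) (u : R * R) :
  dot (rot s u) (rot t u) = cos (t - s) * dot u u.
Proof. by rewrite cosB /dot /rot /=; ring. Qed.

Lemma cross_rot (R : realType) (s t : R) (u : R * R) :
  cross (rot s u) (rot t u) = sin (t - s) * dot u u.
Proof. by rewrite sinB /dot /cross /rot /=; ring. Qed.

Lemma dot_rot2 (R : realType) (t : R) (u v : R * R) :
  dot (rot t u) (rot t v) = dot u v.
Proof.
rewrite -[RHS]mul1r -(cos2Dsin2 t) /dot /rot /=; ring.
Qed.

Lemma spokeD (R : realType) (k i j : nat) (u : R * R) :
  spoke k (spoke k u i) j = spoke k u (i + j).
Proof.
by rewrite /spoke rotD; congr rot; rewrite -mulrDl -mulrDr -natrD addnC.
Qed.

Lemma spoke0 (R : realType) (k : nat) (u : R * R) : spoke k u 0 = u.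
Proof.
rewrite /spoke mulr0 mul0r /rot cos0 sin0 !mul1r !mul0r subr0 add0r.
by case: u.
Qed.

Lemma spokekk (R : realType) (k : nat) (u : R * R) :
  (0 < k)%N -> spoke k u k = u.
Proof.
move=> k0; rewrite /spoke mulfK ?pnatr_eq0 -?lt0n// mulrC mulr_natr /rot.
by rewrite cos2pi sin2pi !mul1r !mul0r subr0 add0r; case: u.
Qed.

Lemma spoke_muln (R : realType) (k j : nat) (u : R * R) :
  (0 < k)%N -> spoke k u (j * k) = u.
Proof.
move=> k0; elim: j => [|j IH]; first by rewrite mul0n spoke0.
by rewrite mulSn -spokeD spokekk.
Qed.

Lemma spoke_mod (R : realType) (k j : nat) (u : R * R) :
  (0 < k)%N -> spoke k u (j %% k) = spoke k u j.
Proof. by move=> k0; rewrite [in RHS](divn_eq j k) -spokeD spoke_muln. Qed.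

Lemma dot_spoke (R : realType) (k j : nat) (u v : R * R) :
  dot (spoke k u j) (spoke k v j) = dot u v.
Proof. exact: dot_rot2. Qed.

Lemma dot_spoke_self (R : realType) (k j : nat) (u : R * R) :
  dot (spoke k u j) (spoke k u j) = dot u u.
Proof. exact: dot_spoke. Qed.

Lemma dot_spokeS (R : realType) (k j : nat) (u : R * R) :
  dot (spoke k u j) (spoke k u j.+1) = cos (2 * pi / k%:R) * dot u u.
Proof.
rewrite /spoke dot_rot; congr (cos _ * _).
by rewrite -mulrBl -mulrBr -natrB// subSnn mulr1.
Qed.

Lemma cross_spokeS (R : realType) (k j : nat) (u : R * R) :
  cross (spoke k u j) (spoke k u j.+1) = sin (2 * pi / k%:R) * dot u u.
Proof.
rewrite /spoke cross_rot; congr (sin _ * _).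
by rewrite -mulrBl -mulrBr -natrB// subSnn mulr1.
Qed.

Lemma cos_spoke_lt1 (R : realType) (k : nat) :
  (2 <= k)%N -> cos (2 * pi / k%:R) < 1 :> R.
Proof.
move=> k2; have k0 : 0 < k%:R :> R by rewrite ltr0n; lia.
have k2' : 2 <= k%:R :> R by rewrite (ler_nat R 2).
have pi0 := pi_gt0 R.
have t0 : 0 < 2 * pi / k%:R :> R by rewrite divr_gt0 ?mulr_gt0.
have tpi : 2 * pi / k%:R <= pi :> R.
  by rewrite ler_pdivrMr// mulrC ler_pM2l.
by rewrite -[ltRHS](@cos0 R) ltr_cos ?in_itv /= ?lexx ?tpi ?t0 ?ltW.
Qed.

Lemma sin_spoke_gt0 (R : realType) (k : nat) :
  (3 <= k)%N -> 0 < sin (2 * pi / k%:R) :> R.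
Proof.
move=> k3; have k0 : 0 < k%:R :> R by rewrite ltr0n; lia.
have k3' : 3 <= k%:R :> R by rewrite (ler_nat R 3).
have pi0 := pi_gt0 R.
apply: sin_gt0_pi; rewrite divr_gt0 ?mulr_gt0//= ltr_pdivrMr//.
by rewrite mulrC ltr_pM2l//; apply: lt_le_trans k3'; rewrite ltr_nat.
Qed.

(** By the triple angle formula c = cos (pi / 3) satisfies
    4 c^3 - 3 c + 1 = (c + 1) (2 c - 1)^2 = 0. *)
Lemma cos_pi3 (R : realType) : cos (pi / 3) = 1 / 2 :> R.
Proof.
have pi0 := pi_gt0 R.
have c0 : 0 < cos (pi / 3) :> R by apply: cos_gt0_pihalf; lra.
have E : cos (pi / 3 + (pi / 3 + pi / 3)) = - 1 :> R.
  by rewrite -(cospi R); congr cos; lra.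
have cs := cos2Dsin2 (pi / 3 : R); move: E c0 cs; rewrite !cosD sinD.
move: (cos _) (sin _) => c s E c0 cs.
have : (c + 1) * (2 * c - 1) ^+ 2 = 0.
  transitivity (c * (c * c - s * s) - s * (s * c + c * s) + 1
                + 3 * c * (c ^+ 2 + s ^+ 2 - 1)); first by ring.
  by rewrite E cs; ring.
by move/eqP; rewrite mulf_eq0 sqrf_eq0 => /orP[] /eqP; lra.
Qed.

Lemma cos_spoke_ge (R : realType) (k : nat) :
  (6 <= k)%N -> 1 / 2 <= cos (2 * pi / k%:R) :> R.
Proof.
move=> k6; have k0 : 0 < k%:R :> R by rewrite ltr0n; lia.
have k6' : 6 <= k%:R :> R by rewrite (ler_nat R 6).
have pi0 := pi_gt0 R.
have h : 2 * pi / k%:R <= pi / 3 :> R by rewrite ler_pdivrMr//; nra.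
have h0 : 0 <= 2 * pi / k%:R :> R by rewrite divr_ge0 ?ltW// mulr_gt0.
by rewrite -cos_pi3 leNgt ltr_cos ?in_itv /= -?leNgt//; apply/andP; split; lra.
Qed.

Lemma cos_spoke3 (R : realType) : cos (2 * pi / 3%:R) = - (1 / 2) :> R.
Proof.
have -> : 2 * pi / 3%:R = pi / 3 + pi / 3 :> R by lra.
have := cos2Dsin2 (pi / 3 : R); rewrite cosD cos_pi3; lra.
Qed.

Lemma cos_spoke5 (R : realType) : 0 <= cos (2 * pi / 5%:R : R) <= 1 / 2.
Proof.
have pi0 := pi_gt0 R; apply/andP; split; first by apply: cos_ge0_pihalf; lra.
rewrite -cos_pi3 leNgt ltr_cos ?in_itv /= -?leNgt.
- lra.
- by apply/andP; split; lra.
- by apply/andP; split; lra.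
Qed.

(** * Angular sectors *)

Lemma spokeS (R : realType) (k j : nat) (u : R * R) :
  spoke k u j.+1 = rot (2 * pi / k%:R) (spoke k u j).
Proof.
by rewrite /spoke rotD; congr (rot _ u); rewrite -natr1; ring.
Qed.

(** For a unit vector a and w with coordinates x along a and y orthogonally to
    it, the premise says that w leans at least as much towards a as towards the
    rotation of a by the angle of cosine c and sine s; so w has not passed that
    rotated vector. *)
Lemma bisector_ineq (R : realType) (c s x y : R) :
  0 < s -> c < 1 -> c ^+ 2 + s ^+ 2 = 1 -> 0 <= y ->
  s * y <= (1 - c) * x -> c * y <= s * x.
Proof.
move=> s0 c1 cs y0 h.
have : s ^+ 2 * y <= (1 - c) * (s * x) by nra.
have -> : s ^+ 2 = (1 - c) * (1 + c) by rewrite -[1 in RHS]cs; nra.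
rewrite -mulrA ler_pM2l ?subr_gt0//; nra.
Qed.

(** The spoke having the largest scalar product with w is the one closest to w
    in direction; w lies in one of the two sectors which that spoke bounds. *)
Lemma sector_cover (R : realType) (k : nat) (u w : R * R) :
  (3 <= k)%N ->
  exists j, 0 <= cross (spoke k u j) w /\ 0 <= cross w (spoke k u j.+1).
Proof.
move=> k3; have k0 : (0 < k)%N by lia.
pose i0 : 'I_k := Ordinal k0.
case: (@arg_maxP _ _ _ i0 xpredT (fun i : 'I_k => dot w (spoke k u i)) isT).
move=> j _ jmax.
have {jmax} maxj n : dot w (spoke k u n) <= dot w (spoke k u j).
  by have := jmax (Ordinal (ltn_pmod n k0)) isT; rewrite /= spoke_mod.
have s0 := sin_spoke_gt0 R k3.
have c1 := @cos_spoke_lt1 R k (ltnW k3).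
have cs := cos2Dsin2 (2 * pi / k%:R : R).
have [jw|jw] := lerP 0 (cross (spoke k u j) w).
  exists j; split=> //; have := maxj j.+1; rewrite spokeS.
  move: (spoke k u j) jw {maxj} s0 c1 cs => a jw.
  rewrite /rot; move: (cos _) (sin _) => c s s0 c1 cs h.
  have := @bisector_ineq _ c s (dot w a) (cross a w) s0 c1 cs jw.
  by move: h jw; rewrite /cross /dot /=; lra.
have ej : spoke k u j = rot (2 * pi / k%:R) (spoke k u (j + k.-1)).
  by rewrite -spokeS -addnS prednK// -spokeD spokekk.
exists (j + k.-1)%N; rewrite spokeS -ej; split; last first.
  by move: jw; rewrite /cross; lra.
have := maxj (j + k.-1)%N; move: jw; rewrite ej.
move: (spoke k u (j + k.-1)) {maxj ej} s0 c1 cs => a.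
move: (2 * pi / k%:R) => t s0 c1 cs jw h.
have cw : 0 <= - cross (rot t a) w by lra.
have := @bisector_ineq _ _ _ (dot w (rot t a)) _ s0 c1 cs cw.
have E1 : sin t * - cross (rot t a) w =
          dot w a - cos t * dot w (rot t a).
  rewrite -[dot w a]mul1r -cs /cross /dot /rot /=; ring.
have E2 : cross a w = cos t * cross (rot t a) w + sin t * dot w (rot t a).
  rewrite -[LHS]mul1r -cs /cross /dot /rot /=; ring.
by rewrite E1 E2; move: h; lra.
Qed.

Lemma cramer (R : realType) (a b z : R * R) :
  cross a b *: z = cross z b *: a + cross a z *: b.
Proof.
rewrite /cross; case: a b z => [a1 a2] [b1 b2] [z1 z2].
congr pair; rewrite /= /GRing.scale/=; ring.
Qed.

Lemma sector_coord (R : realType) (a b z : R * R) :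
  0 < cross a b -> 0 <= cross a z -> 0 <= cross z b ->
  exists x y : R, [/\ 0 <= x, 0 <= y & z = x *: a + y *: b].
Proof.
move=> ab az zb; exists (cross z b / cross a b), (cross a z / cross a b).
split; [exact: divr_ge0 (ltW _)|exact: divr_ge0 (ltW _)|].
rewrite ![_ / _]mulrC -!scalerA -scalerDr -cramer scalerA mulVf ?scale1r//.
by rewrite gt_eqF.
Qed.

Lemma dot_lin2 (R : realType) (a b : R * R) (x y x' y' : R) :
  dot (x *: a + y *: b) (x' *: a + y' *: b) =
  x * x' * dot a a + y * y' * dot b b + (x * y' + y * x') * dot a b.
Proof. by rewrite /dot /= /GRing.scale/=; ring. Qed.

Lemma cross_lin2 (R : realType) (a b : R * R) (x y x' y' : R) :
  cross (x *: a + y *: b) (x' *: a + y' *: b) = (x * y' - y * x') * cross a b.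
Proof. by rewrite /cross /= /GRing.scale/=; ring. Qed.

Lemma dot_cross_sqr (R : realType) (a b : R * R) :
  dot a a * dot b b = dot a b ^+ 2 + cross a b ^+ 2.
Proof. by rewrite /dot /cross; ring. Qed.

(** The bound c >= 1 / 2 on the cosine of the opening forces the angle between z
    and w to be at most pi / 3.  Hence the side z - w of the triangle with third
    vertex 0 faces an angle of at most pi / 3 and cannot be the strictly longest
    side.  The angle bound appears below as cross^2 <= 3 dot^2. *)
Lemma narrow_sector_dist (R : realType) (a b z w : R * R) (c : R) :
  dot b b = dot a a -> dot a b = c * dot a a -> 1 / 2 <= c -> 0 < cross a b ->
  0 <= cross a z -> 0 <= cross z b -> 0 <= cross a w -> 0 <= cross w b ->
  dot (z - w) (z - w) <= Num.max (dot z z) (dot w w).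
Proof.
move=> bb ab c2 s0 az zb aw wb.
have ab2 := dot_cross_sqr a b.
have [x [y [x0 y0 ez]]] := sector_coord s0 az zb.
have [x' [y' [x'0 y'0 ew]]] := sector_coord s0 aw wb.
have r0 := dot_ge0 a.
have D0 : (x * y' + y * x') * dot a a <= 2 * dot z w.
  rewrite ez ew dot_lin2 bb ab -subr_ge0.
  have xy : 0 <= x * y' + y * x' by rewrite addr_ge0 ?mulr_ge0.
  have xx : 0 <= x * x' + y * y' by rewrite addr_ge0 ?mulr_ge0.
  have := mulr_ge0 xx r0; have := mulr_ge0 xy r0.
  move: (x * y' + y * x') => p pr qr.
  have : 0 <= (2 * c - 1) * (p * dot a a) by apply: mulr_ge0 => //; lra.
  by nra.
have pr0 : 0 <= (x * y' + y * x') * dot a a.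
  by apply: mulr_ge0 r0; apply: addr_ge0; apply: mulr_ge0.
have X0 : cross z w ^+ 2 <= 3 * dot z w ^+ 2.
  have h1 : ((x * y' + y * x') * dot a a) ^+ 2 <= (2 * dot z w) ^+ 2.
    by rewrite ler_sqr ?nnegrE// (le_trans _ D0).
  have h2 : cross z w ^+ 2 <= 3 / 4 * ((x * y' + y * x') * dot a a) ^+ 2.
    rewrite ez ew cross_lin2 !exprMn.
    have -> : cross a b ^+ 2 = (1 - c ^+ 2) * dot a a ^+ 2.
      by move: ab2; rewrite bb ab; nra.
    rewrite [leLHS]mulrA [leRHS]mulrA ler_wpM2r ?sqr_ge0//.
    have p0 : (x * y' - y * x') ^+ 2 <= (x * y' + y * x') ^+ 2.
      have := mulr_ge0 (mulr_ge0 x0 y'0) (mulr_ge0 y0 x'0); nra.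
    have cc : 0 <= c ^+ 2 - 1 / 4 by nra.
    have := mulr_ge0 (sqr_ge0 (x * y' - y * x')) cc; move: p0; lra.
  by move: h1 h2; rewrite exprMn; lra.
have D1 : 0 <= dot z w.
  by lra.
have PQ := dot_cross_sqr z w; rewrite dotBB.
have P0 := dot_ge0 z; have Q0 := dot_ge0 w.
have small p q : 0 <= p -> p <= q -> p * q = dot z w ^+ 2 + cross z w ^+ 2 ->
    p <= 2 * dot z w.
  move=> p0 pq e; rewrite -ler_sqr ?nnegrE ?mulr_ge0//; nra.
have [zw|/ltW wz] := lerP (dot z z) (dot w w).
  by have := small _ _ P0 zw PQ; lra.
by have := small _ _ Q0 wz; rewrite mulrC => /(_ PQ); lra.
Qed.

(** The last four hypotheses are the tangents at a and b: they keep both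
    coordinates in the basis (a, b) within [0, 1], so the coordinates of z - w
    are at most 1 in absolute value and the quadratic form gives at most
    (2 + 2 c) |a|^2 <= 3 |a|^2. *)
Lemma truncated_sector_dist (R : realType) (a b z w : R * R) (c : R) :
  dot b b = dot a a -> dot a b = c * dot a a -> 0 <= c -> c <= 1 / 2 ->
  0 < cross a b -> 0 < dot a a ->
  0 <= cross a z -> 0 <= cross z b -> 0 <= cross a w -> 0 <= cross w b ->
  dot z a <= dot a a -> dot z b <= dot a a ->
  dot w a <= dot a a -> dot w b <= dot a a ->
  dot (z - w) (z - w) <= 3 * dot a a.
Proof.
move=> bb ab c0 c2 s0 r0 az zb aw wb za zb' wa wb'.
have unit v : 0 <= cross a v -> 0 <= cross v b ->
    dot v a <= dot a a -> dot v b <= dot a a ->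
    exists x y : R, [/\ 0 <= x <= 1, 0 <= y <= 1 & v = x *: a + y *: b].
  move=> av vb va vb'; have [x [y [x0 y0 ev]]] := sector_coord s0 av vb.
  exists x, y; split=> //; rewrite ?x0 ?y0/=.
    move: va; have -> : dot v a = (x + y * c) * dot a a.
      by rewrite ev dot_linl (dotC b) ab; ring.
    by rewrite ger_pMl//; nra.
  move: vb'; have -> : dot v b = (x * c + y) * dot a a.
    by rewrite ev dot_linl bb ab; ring.
  by rewrite ger_pMl//; nra.
have [x [y [/andP[x0 x1] /andP[y0 y1] ->]]] := unit z az zb za zb'.
have [x' [y' [/andP[x'0 x'1] /andP[y'0 y'1] ->]]] := unit w aw wb wa wb'.
have -> : x *: a + y *: b - (x' *: a + y' *: b) = (x - x') *: a + (y - y') *: b.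
  by rewrite !scalerBl opprD addrACA.
rewrite dot_lin2 bb ab.
have X : (x - x') * (x - x') <= 1 by nra.
have Y : (y - y') * (y - y') <= 1 by nra.
have XY : 2 * ((x - x') * (y - y')) <= 2.
  by have := sqr_ge0 (x - x' - (y - y')); nra.
have XYc : (2 * ((x - x') * (y - y'))) * c <= 1 by nra.
have := ler_wpM2r (ltW r0) (lerD (lerD X Y) XYc); lra.
Qed.

(** * Euclidean disks and the topology of the plane *)

(** The number e is the square of a radius, which keeps square roots out of the
    topological arguments. *)
Lemma nbhs_disk (R : realType) (p : R * R) (A : set (R * R)) :
  nbhs p A <->
  exists2 e : R, 0 < e & forall z, dot (z - p) (z - p) < e -> A z.
Proof.
split=> [/nbhs_ballP[e /= e0 eA]|[e e0 eA]].
  exists (e ^+ 2); first by rewrite exprn_gt0.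
  move=> z; rewrite /dot /= -!expr2 => ze; apply: eA; split=> /=.
    rewrite -ball_normE /= -ltr_sqr ?nnegrE ?(ltW e0)// real_normK ?num_real//.
    have := sqr_ge0 (z.2 - p.2); move: ze; nra.
  rewrite -ball_normE /= -ltr_sqr ?nnegrE ?(ltW e0)// real_normK ?num_real//.
  have := sqr_ge0 (z.1 - p.1); move: ze; nra.
apply/nbhs_ballP; exists (Num.sqrt (e / 2)).
  by rewrite /= sqrtr_gt0 divr_gt0.
have e2 : 0 <= e / 2 by lra.
have sq (a b : R) : ball a (Num.sqrt (e / 2)) b -> (b - a) ^+ 2 < e / 2.
  rewrite -ball_normE /= -(@ltr_pXn2r _ 2%N) ?nnegrE ?sqrtr_ge0//.
  by rewrite real_normK ?num_real// sqr_sqrtr// -sqrrN opprB.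
move=> z [/= /sq z1 /sq z2]; apply: eA; rewrite /dot /= -!expr2; lra.
Qed.

Lemma closure_disk (R : realType) (A : set (R * R)) (z : R * R) :
  closure A z <->
  forall e : R, 0 < e -> exists2 y, A y & dot (y - z) (y - z) < e.
Proof.
split=> [zA e e0|zA B /nbhs_disk[e e0 eB]].
  have [] := zA [set y | dot (y - z) (y - z) < e].
    by apply/nbhs_disk; exists e.
  by move=> y [Ay ye]; exists y.
by have [y Ay ye] := zA e e0; exists y; split=> //; exact: eB.
Qed.

Lemma convex_segment (R : realType) (C : set (R * R)) (a b : R * R) (t : R) :
  convex_set C -> C a -> C b -> 0 <= t <= 1 -> C (a + t *: (b - a)).
Proof.
move=> cC Ca Cb /andP[t0 t1].
have := cC b a (Itv01 t0 t1); rewrite !inE => /(_ Cb Ca).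
rewrite /conv /= /unstable.onem => h.
have -> // : a + t *: (b - a) = t *: b + (1 - t) *: a.
by rewrite scalerBr scalerBl scale1r addrCA.
Qed.

Lemma line_segment_connected (R : realType) (a b : R * R) :
  connected [set a + t *: (b - a) | t in `[0, 1]%classic].
Proof.
apply: connected_continuous_connected; first exact: segment_connected.
apply: continuous_subspaceT => t.
by apply: cvgD; [exact: cvg_cst|apply: cvgZr_tmp; exact: cvg_id].
Qed.

Lemma cross_continuous (R : realType) (a p : R * R) :
  continuous (fun z : R * R => cross a (z - p)).
Proof.
move=> z; rewrite /cross /=.
apply: cvgB; (apply: cvgM; first exact: cvg_cst); apply: cvgB;
  (exact: cvg_fst || exact: cvg_snd || exact: cvg_cst).
Qed.

Lemma dist_continuous (R : realType) (p : R * R) :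
  continuous (fun z : R * R => dot (z - p) (z - p)).
Proof.
move=> z; rewrite /dot /=.
by apply: cvgD; apply: cvgM; apply: cvgB;
  (exact: cvg_fst || exact: cvg_snd || exact: cvg_cst).
Qed.

(** * The center of symmetry *)

Lemma fixed_rot_eq0 (R : realType) (t : R) (u : R * R) :
  cos t < 1 -> rot t u = u -> u = 0.
Proof.
move=> t1 ut; apply/eqP; apply/negPn/negP => /dot_gt0 u0.
have : dot u (rot t u) = cos t * dot u u by rewrite /dot /rot /=; ring.
rewrite ut; nra.
Qed.

Lemma sum_spoke (R : realType) (k : nat) (u : R * R) :
  (2 <= k)%N -> \sum_(j < k) spoke k u j = 0.
Proof.
move=> k2; apply: (fixed_rot_eq0 (cos_spoke_lt1 R k2)).
rewrite rot_sum; under eq_bigr do rewrite -spokeS.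
apply: (addrI (spoke k u 0)).
rewrite -(big_ord_recl k (fun j : 'I_k.+1 => spoke k u j)) big_ord_recr /=.
by rewrite spokekk ?spoke0 1?addrC//; lia.
Qed.

Lemma orbit_in (R : realType) (C : set (R * R)) (k j : nat) (p z : R * R) :
  center_of_symmetry C k p -> C z -> C (p + spoke k (z - p) j).
Proof.
move=> [_ rC] Cz; elim: j => [|j IH]; first by rewrite spoke0 addrC subrK.
rewrite -rC; exists (p + spoke k (z - p) j) => //.
by rewrite rotationE spokeS addrAC subrr add0r.
Qed.

Lemma convex_mean (R : realType) (C : set (R * R)) (n : nat)
    (f : nat -> R * R) :
  convex_set C -> (forall i, C (f i)) ->
  C (n.+1%:R^-1 *: \sum_(i < n.+1) f i).
Proof.
move=> cC Cf; elim: n => [|n IH]; first by rewrite big_ord1 invr1 scale1r.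
have n0 : 0 < n.+2%:R :> R by rewrite ltr0n.
have n1 : 0 < n.+1%:R :> R by rewrite ltr0n.
rewrite big_ord_recr /=; set s := \sum_(i < n.+1) f i in IH *.
have -> : n.+2%:R^-1 *: (s + f n.+1) =
  n.+1%:R^-1 *: s + n.+2%:R^-1 *: (f n.+1 - n.+1%:R^-1 *: s).
  rewrite -[n.+2%:R]natr1; move: n.+1%:R n1 s (f _) {IH} => m m0 [s1 s2] [a b].
  by congr pair; rewrite /= /GRing.scale /=; field; rewrite !lt0r_neq0//; lra.
have t01 : 0 <= (n.+2%:R^-1 : R) <= 1.
  by rewrite invr_ge0 (ltW n0) /= invf_le1// ler1n.
exact: convex_segment.
Qed.

(** C contains a disk around some point z, hence congruent disks around the
    images of z under the rotations.  Their mean is a disk of the same radius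
    around p, because the rotated copies of z - p sum to zero. *)
Lemma center_interior (R : realType) (C : set (R * R)) (k : nat) (p : R * R) :
  planar_convex_body C -> (2 <= k)%N -> center_of_symmetry C k p ->
  nbhs p C.
Proof.
move=> [_ cC [z /nbhs_disk[e e0 eC]]] k2 pC.
apply/nbhs_disk; exists e => // v ve.
have k0 : (0 < k)%N by lia.
(* Rotating j * k.-1 times inverts rotating j times, so f j is the sum of v
   and of the j-th rotated copy of z - p. *)
pose f j := p + spoke k (z - p + spoke k (v - p) (j * k.-1)) j.
have Cf j : C (f j).
  have := @orbit_in _ C k j p (z + spoke k (v - p) (j * k.-1)) pC.
  rewrite addrAC; apply; apply: eC.
  by rewrite addrC addKr dot_spoke.
have fE j : f j = spoke k (z - p) j + v.
  have -> : f j = p + (spoke k (z - p) j + (v - p)).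
    rewrite /f; congr (_ + _).
    set w := spoke k (v - p) (j * k.-1).
    have <- : spoke k w j = v - p.
      by rewrite spokeD addnC -mulnS prednK// spoke_muln.
    by rewrite /spoke /rot; congr pair => /=; ring.
  by rewrite addrCA [p + _]addrC subrK.
have := @convex_mean _ C k.-1 f cC Cf; rewrite prednK//.
under eq_bigr do rewrite fE.
rewrite big_split /= sum_spoke// add0r sumr_const card_ord -[v *+ k]scaler_nat.
by rewrite scalerA mulVf ?scale1r// pnatr_eq0 -lt0n.
Qed.

(** The rotated copies of z - p sum to zero, so one of them makes a nonnegative
    scalar product with p - q. *)
Lemma exists_farther (R : realType) (C : set (R * R)) (k : nat)
    (p q z : R * R) :
  (2 <= k)%N -> center_of_symmetry C k p -> C z ->
  exists2 y, C y &
    dot (z - p) (z - p) + dot (p - q) (p - q) <= dot (y - q) (y - q).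
Proof.
move=> k2 pC Cz.
have [j jP] : exists j, 0 <= dot (spoke k (z - p) j) (p - q).
  apply: contrapT => /forallNP no.
  have : dot (\sum_(j < k) spoke k (z - p) j) (p - q) < 0.
    have -> : dot (\sum_(j < k) spoke k (z - p) j) (p - q) =
              \sum_(j < k) dot (spoke k (z - p) j) (p - q).
      apply: (big_morph (fun u => dot u (p - q))) => [u v|];
        by rewrite /dot /=; ring.
    apply: (@lt_le_trans _ _ (\sum_(j < k) (0 : R))); last by rewrite big1.
    apply: ltr_sum => [|i _]; last by rewrite ltNge; apply/negP.
    by apply/hasP; exists (Ordinal (ltnW k2)) => //; rewrite mem_index_enum.
  by rewrite sum_spoke// /dot /= !mul0r addr0 ltxx.
exists (p + spoke k (z - p) j); first exact: orbit_in.
have -> : p + spoke k (z - p) j - q = spoke k (z - p) j + (p - q).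
  by rewrite [p + _]addrC addrA.
rewrite -[X in X + _ <= _](dot_spoke k j).
by move: jP; move: (spoke _ _ _) (p - q) => a b; rewrite /dot /=; lra.
Qed.

Lemma compact_dist_max (R : realType) (C : set (R * R)) (p : R * R) :
  compact C -> C !=set0 ->
  exists2 y, C y & forall z, C z -> dot (z - p) (z - p) <= dot (y - p) (y - p).
Proof.
move=> kC C0.
have [] := @compact_EVT_max _ R (fun z : R * R => dot (z - p) (z - p)) C C0 kC.
  exact/continuous_subspaceT/dist_continuous.
move=> y; rewrite inE => Cy ymax; exists y => // z Cz.
by apply: ymax; rewrite inE.
Qed.

(** If p <> q, going from a farthest point y of p to a point farther from q and
    back to one farther from p increases the maximal distance to p. *)
Lemma center_unique (R : realType) (C : set (R * R)) (k l : nat) (p q : R * R) :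
  compact C -> (2 <= k)%N -> (2 <= l)%N ->
  center_of_symmetry C k p -> center_of_symmetry C l q -> p = q.
Proof.
move=> kC k2 l2 pC qC.
have [y Cy ymax] : exists2 y, C y &
    forall z, C z -> dot (z - p) (z - p) <= dot (y - p) (y - p).
  by apply: compact_dist_max => //; exists p; case: pC.
have [y' Cy' yy'] := exists_farther q k2 pC Cy.
have [y'' Cy'' y'y''] := exists_farther p l2 qC Cy'.
apply/eqP; rewrite -subr_eq0; apply/negPn/negP => /dot_gt0 pq.
have := ymax _ Cy''; have := dot_ge0 (q - p).
lra.
Qed.

(** * The inscribed disk *)

(** The disk around p through x is the largest one centered at p inside C. *)
Definition inscribed {R : realType} (C : set (R * R)) (p x : R * R) : Prop :=
  [/\ closed C, convex_set C, nbhs p C & nearest_boundary_point C p x].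

Lemma nearest_dot_le (R : realType) (C : set (R * R)) (p x y : R * R) :
  nearest_boundary_point C p x -> boundary C y ->
  dot (x - p) (x - p) <= dot (y - p) (y - p).
Proof.
move=> [_ near] /near.
by rewrite ![eucl_dist p _]eucl_distC !eucl_distE ler_sqrt// dot_ge0.
Qed.

(** A segment from p that stays closer to p than the boundary is connected and
    meets C in a set both open and closed in it. *)
Lemma open_disk_sub (R : realType) (C : set (R * R)) (p x z : R * R) :
  inscribed C p x -> dot (z - p) (z - p) < dot (x - p) (x - p) -> C z.
Proof.
move=> [clC cC pC near] zx.
pose A := [set p + t *: (z - p) | t in `[0, 1]%classic].
have AC : A `&` C = A `&` interior C.
  apply/seteqP; split=> y [Ay Cy]; split=> //; last exact: interior_subset.
  apply: contrapT => nCy.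
  have := nearest_dot_le near (conj (subset_closure Cy) nCy).
  have [t /= + <-] := Ay; rewrite in_itv /= => /andP[t0 t1].
  rewrite [p + _]addrC addrK dotZZ => xt.
  have tt : t ^+ 2 <= 1 by rewrite expr2 mulr_ile1.
  have := ler_wpM2r (dot_ge0 (z - p)) tt; lra.
have Ap : A p by exists 0; rewrite /= ?in_itv /= ?lexx ?ler01// scale0r addr0.
have Az : A z.
  by exists 1; rewrite /= ?in_itv /= ?lexx ?ler01// scale1r addrC subrK.
have : A `&` C = A; last by move=> AE; move: Az; rewrite -AE => -[].
apply: (@line_segment_connected R p z).
- by exists p; split=> //; exact: nbhs_singleton.
- by exists (interior C) => //; exact: open_interior.
- by exists C.
Qed.

Lemma radius_gt0 (R : realType) (C : set (R * R)) (p x : R * R) :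
  inscribed C p x -> 0 < dot (x - p) (x - p).
Proof.
move=> [_ _ pC [[_ xC] _]]; apply: dot_gt0; rewrite subr_eq0.
by apply: contra_notN xC => /eqP ->.
Qed.

Lemma small_scaling (R : realType) (d e : R) : 0 <= d -> 0 < e ->
  exists s : R, [/\ 0 < s, s < 1 & s ^+ 2 * d < e].
Proof.
move=> d0 e0; have D0 : 0 < e + d + 1 by lra.
have se : e / (e + d + 1) * (e + d + 1) = e by rewrite divfK// gt_eqF.
have s0 : 0 < e / (e + d + 1) by rewrite divr_gt0.
have s1 : e / (e + d + 1) < 1 by rewrite ltr_pdivrMr//; lra.
exists (e / (e + d + 1)); split=> //; move: (e / _) s0 s1 se => s s0 s1 se.
have ss : s ^+ 2 <= s by nra.
by apply: (le_lt_trans (ler_wpM2r d0 ss)); nra.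
Qed.

Lemma closed_disk_sub (R : realType) (C : set (R * R)) (p x z : R * R) :
  inscribed C p x -> dot (z - p) (z - p) <= dot (x - p) (x - p) -> C z.
Proof.
move=> Cx zx; have [clC _ _ _] := Cx; have r0 := radius_gt0 Cx.
apply/clC/closure_disk => e e0.
set r := dot (x - p) (x - p) in zx r0 *.
have [s [s0 s1 se]] := small_scaling (ltW r0) e0.
exists (p + (1 - s) *: (z - p)).
  apply: (open_disk_sub Cx); rewrite [p + _]addrC addrK dotZZ.
  apply: (le_lt_trans (ler_wpM2l (sqr_ge0 _) zx)); rewrite gtr_pMl//; nra.
have -> : p + (1 - s) *: (z - p) - z = (- s) *: (z - p).
  by apply: vec_eq; rewrite /= /GRing.scale/=; ring.
rewrite dotZZ; apply: (le_lt_trans (ler_wpM2l (sqr_ge0 _) zx)).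
by rewrite sqrrN.
Qed.

(** If z were strictly beyond the tangent at x, then x would be interior to the
    convex hull of z and the open disk inscribed in C. *)
Lemma tangent_halfplane (R : realType) (C : set (R * R)) (p x z : R * R) :
  inscribed C p x -> C z -> dot (z - p) (x - p) <= dot (x - p) (x - p).
Proof.
move=> Cx Cz; have r0 := radius_gt0 Cx; have [_ cC _ [[_ xC] _]] := Cx.
rewrite leNgt; apply/negP => zx; apply: xC.
set r := dot (x - p) (x - p) in r0 zx.
set D := dot (z - p) (x - p) in zx.
pose W := dot (z - p) (z - p); have W0 : 0 <= W := dot_ge0 _.
(* x is the point at parameter t on the segment to z from a point b of the
   disk; that b falls inside the disk when t W < 2 (D - r), which this t
   ensures. *)
pose t := (D - r) / (D - r + W + 1).
have d0 : 0 < D - r + W + 1 by lra.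
have te : t * (D - r + W + 1) = D - r by rewrite /t divfK// gt_eqF.
have t0 : 0 < t by rewrite divr_gt0//; lra.
have t1 : t < 1 by rewrite ltr_pdivrMr//; lra.
pose q := p + t *: (z - p).
have qx : dot (x - q) (x - q) < (1 - t) ^+ 2 * r.
  have -> : dot (x - q) (x - q) = r - 2 * t * D + t ^+ 2 * W.
    by rewrite /q /r /D /W /dot /= /GRing.scale/=; ring.
  have : t * W < 2 * (D - r) by nra.
  nra.
have : nbhs x [set v | dot (v - q) (v - q) < (1 - t) ^+ 2 * r].
  apply: open_nbhs_nbhs; split=> //.
  exact: (open_comp (fun z _ => @dist_continuous R q z) (@open_lt R _)).
apply: filterS => v /= vq.
pose b := p + (1 - t)^-1 *: (v - q).
have Cb : C b.
  apply: (open_disk_sub Cx); rewrite [b - p]addrC addKr dotZZ -/r.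
  have t2 : 0 < (1 - t) ^+ 2 by rewrite exprn_gt0// subr_gt0.
  by rewrite exprVn mulrC ltr_pdivrMr// mulrC.
have -> : v = b + t *: (z - b).
  have tn : 1 - t != 0 by rewrite gt_eqF// subr_gt0.
  rewrite /b /q; case: (v) (p) (z) => [v1 v2] [p1 p2] [z1 z2].
  by congr pair; rewrite /= /GRing.scale /=; field.
by apply: convex_segment => //; rewrite !ltW.
Qed.

Lemma disk_rot_symmetric (R : realType) (C : set (R * R)) (p x : R * R)
    (k : nat) :
  inscribed C p x -> (2 <= k)%N ->
  (forall z, C z -> dot (z - p) (z - p) <= dot (x - p) (x - p)) ->
  rot_symmetric C k.
Proof.
move=> Cx k2 CD; split=> //; exists p; split.
  by have [_ _ /nbhs_singleton] := Cx.
have inC t z : C z -> C (p + rot t (z - p)).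
  move=> Cz; apply: (closed_disk_sub Cx).
  by rewrite [p + _]addrC addrK dot_rot2 CD.
apply/seteqP; split=> [_ [z Cz <-]|z Cz].
  by rewrite rotationE; exact: inC.
set t := 2 * pi / k%:R; exists (p + rot (- t) (z - p)); first exact: inC.
rewrite rotationE [p + rot (- t) _]addrC addrK rotD subrr /rot cos0 sin0.
by rewrite !mul1r !mul0r subr0 add0r; case: (z) (p) => ? ? [? ?];
  congr pair; rewrite /= addrC subrK.
Qed.

(** A body without such a point is a disk, hence symmetric of every order. *)
Lemma far_point (R : realType) (C : set (R * R)) (p x : R * R) (k : nat) :
  inscribed C p x -> (2 <= k)%N -> ~ rot_symmetric C k ->
  exists2 y, C y & dot (x - p) (x - p) < dot (y - p) (y - p).
Proof.
move=> Cx k2 nsym; apply: contrapT => /forall2NP no; apply: nsym.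
apply: (disk_rot_symmetric Cx) => // z Cz.
by have [//|/negP] := no z; rewrite -leNgt.
Qed.

(** * The pieces of a standard partition *)

Lemma spokesP (R : realType) (k : nat) (p x z : R * R) : (0 < k)%N ->
  spokes k p x z <->
  exists j (t : R), 0 <= t <= 1 /\ z = p + t *: spoke k (x - p) j.
Proof.
move=> k0; split=> [[j /= jk [t [t01 ->]]]|[j [t [t01 ->]]]].
  by exists j, t; split=> //; rewrite rotationE addrAC subrr add0r.
exists (j %% k)%N; first by rewrite /= ltn_pmod.
exists t; split=> //; rewrite rotationE addrAC subrr add0r.
by rewrite -[in LHS]spoke_mod.
Qed.

Lemma tangent_halfplane_spoke (R : realType) (C : set (R * R)) (p x z : R * R)
    (k j : nat) :
  (0 < k)%N -> inscribed C p x -> center_of_symmetry C k p -> C z ->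
  dot (z - p) (spoke k (x - p) j) <= dot (x - p) (x - p).
Proof.
move=> k0 Cx pC Cz; have := tangent_halfplane Cx (orbit_in (j * k.-1) pC Cz).
rewrite [p + _]addrC addrK -(dot_spoke k j) spokeD addnC -mulnS prednK//.
by rewrite spoke_muln.
Qed.

Lemma cross0_parallel (R : realType) (a w : R * R) :
  0 < dot a a -> cross a w = 0 -> w = (dot w a / dot a a) *: a.
Proof.
move=> a0 aw; have an : dot a a != 0 by rewrite gt_eqF.
apply: (scalerI an); rewrite scalerA mulrCA divff// mulr1.
have -> : dot a a *: w = dot w a *: a + cross a w *: (- a.2, a.1).
  by apply: vec_eq; rewrite /dot /cross /= /GRing.scale /=; ring.
by rewrite aw scale0r addr0.
Qed.

(** The tangent at the end of a spoke cuts off the rest of its ray, so within C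
    the ray is the spoke. *)
Lemma ray_in_spokes (R : realType) (C : set (R * R)) (p x z : R * R) (k j : nat)
    (s : R) :
  (0 < k)%N -> inscribed C p x -> center_of_symmetry C k p -> C z ->
  0 <= s -> z - p = s *: spoke k (x - p) j -> spokes k p x z.
Proof.
move=> k0 Cx pC Cz s0 zs; apply/(spokesP _ _ _ k0).
exists j, s; split; last first.
  by rewrite -zs addrC subrK.
rewrite s0 /=; have := tangent_halfplane_spoke j k0 Cx pC Cz; rewrite zs.
have -> : dot (s *: spoke k (x - p) j) (spoke k (x - p) j) =
          s * dot (x - p) (x - p).
  by rewrite -(dot_spoke_self k j) /dot /= /GRing.scale/=; ring.
by rewrite ger_pMl// (radius_gt0 Cx).
Qed.

Lemma sector_edge (R : realType) (C : set (R * R)) (p x z : R * R) (k j : nat) :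
  (3 <= k)%N -> inscribed C p x -> center_of_symmetry C k p -> C z ->
  0 <= cross (spoke k (x - p) j) (z - p) ->
  0 <= cross (z - p) (spoke k (x - p) j.+1) ->
  ~ spokes k p x z ->
  0 < cross (spoke k (x - p) j) (z - p) /\
  0 < cross (z - p) (spoke k (x - p) j.+1).
Proof.
move=> k3 Cx pC Cz; have k0 : (0 < k)%N by lia.
have r0 := radius_gt0 Cx.
have ab0 : 0 < cross (spoke k (x - p) j) (spoke k (x - p) j.+1).
  by rewrite cross_spokeS mulr_gt0// sin_spoke_gt0.
have aa : 0 < dot (spoke k (x - p) j) (spoke k (x - p) j).
  by rewrite dot_spoke_self.
have bb : 0 < dot (spoke k (x - p) j.+1) (spoke k (x - p) j.+1).
  by rewrite dot_spoke_self.
have ray i s := @ray_in_spokes _ C p x z k i s k0 Cx pC Cz.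
move: ray aa bb ab0.
set a := spoke k (x - p) j; set b := spoke k (x - p) j.+1; set w := z - p.
move=> ray aa bb ab0 aw wb nS; split; rewrite lt0r ?aw ?wb andbT;
  apply/eqP => e; apply: nS.
  have ew := cross0_parallel aa e; apply: (ray j _ _ ew).
  move: wb; rewrite [X in cross X _]ew.
  have -> : forall s, cross (s *: a) b = s * cross a b.
    by move=> s; rewrite /cross /= /GRing.scale/=; ring.
  by rewrite pmulr_lge0.
have e' : cross b w = 0 by move: e; rewrite /cross; lra.
have ew := cross0_parallel bb e'; apply: (ray j.+1 _ _ ew).
move: aw; rewrite [X in cross _ X]ew.
have -> : forall s, cross a (s *: b) = s * cross a b.
  by move=> s; rewrite /cross /= /GRing.scale/=; ring.
by rewrite pmulr_lge0.
Qed.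

Lemma crossNC (R : realType) (a b : R * R) : cross (- b) a = cross a b.
Proof. by rewrite /cross /=; ring. Qed.

Lemma piece_sub (R : realType) (C S A : set (R * R)) :
  closed C -> pieces C S A -> A `<=` C.
Proof.
move=> clC [y _ <-]; apply: subset_trans clC; apply: closure_subset.
by move=> z /connected_component_sub[].
Qed.

Lemma piece_nonempty (R : realType) (C S A : set (R * R)) :
  pieces C S A -> A !=set0.
Proof.
move=> [y Cy <-]; exists y; apply: subset_closure.
exact: connected_component_refl.
Qed.

(** Off the spokes the open and the closed sector have the same points
    ([sector_edge]), so their common trace on a connected component is open and
    closed in it. *)
Lemma piece_in_sector (R : realType) (C A : set (R * R)) (p x : R * R)
    (k : nat) :
  (3 <= k)%N -> inscribed C p x -> center_of_symmetry C k p ->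
  pieces C (spokes k p x) A ->
  exists j, forall z, A z -> 0 <= cross (spoke k (x - p) j) (z - p) /\
                             0 <= cross (z - p) (spoke k (x - p) j.+1).
Proof.
move=> k3 Cx pC [y [Cy Sy] <-].
have [j [ay yb]] := @sector_cover _ k (x - p) (y - p) k3.
exists j; set K := connected_component _ y.
move: ay yb; set a := spoke k (x - p) j; set b := spoke k (x - p) j.+1 => ay yb.
have edge z : K z -> 0 <= cross a (z - p) -> 0 <= cross (z - p) b ->
    0 < cross a (z - p) /\ 0 < cross (z - p) b.
  move=> /connected_component_sub[Cz nS] az zb.
  exact: (sector_edge k3 Cx pC Cz az zb nS).
pose f c := fun z : R * R => cross c (z - p).
have cf c : continuous (f c) by exact: cross_continuous.
pose U := (f a @^-1` [set r | 0 < r]) `&` (f (- b) @^-1` [set r | 0 < r]).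
pose V := (f a @^-1` [set r | 0 <= r]) `&` (f (- b) @^-1` [set r | 0 <= r]).
have oU : open U.
  by apply: openI; apply: open_comp; rewrite //=; exact: open_gt.
have cV : closed V.
  by apply: closedI; apply: closed_comp; rewrite //=; exact: closed_ge.
have KUV : K `&` U = K `&` V.
  apply/seteqP; split=> z [Kz [h h']]; split=> //; move: h h'.
    by rewrite /V /f /= => /ltW ? /ltW ?.
  by rewrite /U /V /f /= crossNC => h h'; exact: edge.
have Ky : K y by exact: connected_component_refl.
have KU : K `&` U = K.
  apply: (@component_connected _ (C `\` spokes k p x) y).
  - by exists y; rewrite KUV; split; rewrite // /V /f /= crossNC.
  - by exists U.
  - by exists V.
have KV : closure K `<=` V.
  apply: subset_trans cV; apply: closure_subset.
  by rewrite -KU KUV; exact: subIsetr.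
by move=> z /KV[]; rewrite /f /= crossNC.
Qed.

Lemma joined_in_piece (R : realType) (C S : set (R * R)) (a b : R * R) :
  (forall t : R, 0 < t < 1 -> (C `\` S) (a + t *: (b - a))) ->
  exists A, [/\ pieces C S A, A a & A b].
Proof.
move=> ab; pose g (t : R) := a + t *: (b - a).
have cg : continuous g.
  by move=> t; apply: cvgD; [exact: cvg_cst|apply: cvgZr_tmp; exact: cvg_id].
pose L := [set g t | t in `]0, 1[%classic].
have cL : connected L.
  apply: connected_continuous_connected; last exact: continuous_subspaceT.
  by apply/connected_intervalP; exact: interval_is_interval.
have h0 : 0 < (1 / 2 : R) < 1 by apply/andP; split; lra.
pose y := g (1 / 2).
have Ly : L y by exists (1 / 2) => //=; rewrite in_itv.
have LCS : L `<=` C `\` S.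
  by move=> _ [t /= t01 <-]; apply: ab; rewrite in_itv in t01.
have LK := connected_component_max Ly LCS cL.
exists (closure (connected_component (C `\` S) y)); split.
- by exists y => //; exact: LCS.
- apply: (closure_subset LK); apply/closure_disk => e e0.
  have [s [s0 s1 se]] := small_scaling (dot_ge0 (b - a)) e0.
  exists (g s); first by exists s => //=; rewrite in_itv /= s0.
  by rewrite /g [a + _]addrC addrK dotZZ.
- apply: (closure_subset LK); apply/closure_disk => e e0.
  have [s [s0 s1 se]] := small_scaling (dot_ge0 (b - a)) e0.
  exists (g (1 - s)).
    by exists (1 - s) => //=; rewrite in_itv /=; apply/andP; split; lra.
  have -> : g (1 - s) - b = (- s) *: (b - a).
    by apply: vec_eq; rewrite /= /GRing.scale/=; ring.
  by rewrite dotZZ sqrrN.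
Qed.

(** * Bounds for the maximum relative diameter *)

Lemma dist_bounded (R : realType) (C : set (R * R)) :
  compact C -> exists M : R, forall a b, C a -> C b -> eucl_dist a b <= M.
Proof.
move=> kC; have [C0|nC] := pselect (C !=set0); last first.
  by exists 0 => a b Ca; exfalso; apply: nC; exists a.
have [p Cp] := C0; have [y Cy ymax] := compact_dist_max p kC C0.
exists (Num.sqrt (4 * dot (y - p) (y - p))) => a b Ca Cb.
rewrite eucl_distE ler_sqrt ?mulr_ge0 ?dot_ge0//.
have parallelogram : dot (a - b) (a - b) =
  2 * dot (a - p) (a - p) + 2 * dot (b - p) (b - p)
  - dot ((a - p) + (b - p)) ((a - p) + (b - p)).
  by rewrite /dot /=; ring.
have := ymax _ Ca; have := ymax _ Cb; have := dot_ge0 ((a - p) + (b - p)).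
by rewrite parallelogram; lra.
Qed.

Lemma le_max_rel_diameter (R : realType) (C S A : set (R * R)) (a b : R * R) :
  compact C -> closed C -> pieces C S A -> A a -> A b ->
  eucl_dist a b <= max_rel_diameter (pieces C S).
Proof.
move=> kC clC PA Aa Ab; have [M CM] := dist_bounded kC.
have DM B : pieces C S B ->
    has_ubound [set d | exists x y, [/\ B x, B y & d = eucl_dist x y]].
  move=> PB; exists M => _ [x [y [Bx By ->]]].
  by apply: CM; exact: (piece_sub clC PB).
apply: (@le_trans _ _ (diameter A)).
  by apply: (ub_le_sup (DM A PA)); exists a, b.
apply: ub_le_sup; last by exists A.
exists M => _ [B PB <-]; apply: ge_sup.
  by have [y By] := piece_nonempty PB; exists (eucl_dist y y), y, y.
by move=> _ [x [y [Bx By ->]]]; apply: CM; exact: (piece_sub clC PB).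
Qed.

Lemma max_rel_diameter_le (R : realType) (C S : set (R * R)) (d : R) :
  C `\` S !=set0 ->
  (forall A a b, pieces C S A -> A a -> A b -> eucl_dist a b <= d) ->
  max_rel_diameter (pieces C S) <= d.
Proof.
move=> [y Cy] H; apply: ge_sup.
  pose A := closure (connected_component (C `\` S) y).
  by exists (diameter A), A => //; exists y.
move=> _ [A PA <-]; apply: ge_sup.
  by have [z Az] := piece_nonempty PA; exists (eucl_dist z z), z, z.
by move=> _ [a [b [Aa Ab ->]]]; exact: H PA Aa Ab.
Qed.

Lemma spokes_dist (R : realType) (p x z : R * R) (k : nat) :
  (0 < k)%N -> spokes k p x z -> dot (z - p) (z - p) <= dot (x - p) (x - p).
Proof.
move=> k0 /(spokesP _ _ _ k0)[j [t [/andP[t0 t1] ->]]].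
rewrite [p + _]addrC addrK dotZZ dot_spoke_self.
by rewrite -[leRHS]mul1r ler_wpM2r ?dot_ge0// expr2 mulr_ile1.
Qed.

(** If y is off the spokes, so is the half-open segment from p to y, and its
    piece has both ends in its closure.  Otherwise y is at distance at most r
    from p, less than a point of C outside the inscribed disk, which is off the
    spokes. *)
Lemma center_dist_le (R : realType) (C : set (R * R)) (p x y : R * R)
    (k : nat) :
  (0 < k)%N -> compact C -> inscribed C p x -> center_of_symmetry C k p ->
  (exists2 z, C z & dot (x - p) (x - p) < dot (z - p) (z - p)) ->
  C y -> eucl_dist y p <= max_rel_diameter (pieces C (spokes k p x)).
Proof.
move=> k0 kC Cx pC [z Cz xz] Cy; have [clC cC /nbhs_singleton Cp _] := Cx.
have off v : C v -> ~ spokes k p x v ->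
    eucl_dist v p <= max_rel_diameter (pieces C (spokes k p x)).
  move=> Cv nS.
  have [] := @joined_in_piece _ C (spokes k p x) p v; last first.
    by move=> A [PA Ap Av]; exact: le_max_rel_diameter PA Av Ap.
  move=> t /andP[t0 t1]; split; first by apply: convex_segment; rewrite // !ltW.
  move/(spokesP _ _ _ k0) => [j [s [/andP[s0 s1] /addrI e]]]; apply: nS.
  apply: (@ray_in_spokes _ C p x v k j (t^-1 * s)) => //.
    by rewrite mulr_ge0// invr_ge0 ltW.
  by rewrite -scalerA -e scalerA mulVf ?scale1r// gt_eqF.
have [Sy|nSy] := pselect (spokes k p x y); last exact: off.
apply: le_trans (off z Cz _); last first.
  by move/(spokes_dist k0); rewrite leNgt xz.
rewrite !eucl_distE ler_sqrt ?dot_ge0//.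
by apply: le_trans (ltW xz); exact: spokes_dist Sy.
Qed.

(** The chord between the ends of two spokes at angle 2 pi / 3 has length
    r sqrt 3, and its interior meets no spoke: the third one points to the
    opposite side of p. *)
Lemma triangle_dist_le (R : realType) (C : set (R * R)) (p x : R * R) :
  compact C -> inscribed C p x -> center_of_symmetry C 3 p ->
  Num.sqrt (3 * dot (x - p) (x - p)) <=
  max_rel_diameter (pieces C (spokes 3 p x)).
Proof.
move=> kC Cx pC; have [clC cC _ [[xC _] _]] := Cx.
have r0 := radius_gt0 Cx.
set u := x - p in r0 *.
pose y j := p + spoke 3 u j.
have Cy j : C (y j) by apply: orbit_in => //; exact: clC.
have -> : Num.sqrt (3 * dot u u) = eucl_dist (y 0%N) (y 1%N).
  rewrite eucl_distE; congr Num.sqrt.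
  have -> : y 0%N - y 1%N = spoke 3 u 0 - spoke 3 u 1.
    by rewrite /y opprD addrACA subrr add0r.
  by rewrite dotBB dot_spokeS !dot_spoke_self cos_spoke3; lra.
have [] := @joined_in_piece _ C (spokes 3 p x) (y 0%N) (y 1%N); last first.
  by move=> A [PA A0 A1]; exact: le_max_rel_diameter PA A0 A1.
move=> t /andP[t0 t1]; split; first by apply: convex_segment; rewrite // !ltW.
move/(spokesP _ _ _ (isT : (0 < 3)%N)) => [j [s [/andP[s0 s1]]]].
have c3 j' := @cross_spokeS _ 3 j' u.
have r1 : 0 < sin (2 * pi / 3%:R) * dot u u by rewrite mulr_gt0// sin_spoke_gt0.
rewrite -/u -(spoke_mod j)// /y.
have -> : p + spoke 3 u 0 + t *: (p + spoke 3 u 1 - (p + spoke 3 u 0)) =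
          p + ((1 - t) *: spoke 3 u 0 + t *: spoke 3 u 1).
  by apply: vec_eq; rewrite /= /GRing.scale/=; ring.
move/addrI => e.
have s3 : spoke 3 u 2 = - spoke 3 u 0 - spoke 3 u 1.
  have := @sum_spoke _ 3 u isT; rewrite !big_ord_recr big_ord0 /= add0r => e3.
  by rewrite -opprD; apply/eqP; rewrite -addr_eq0 addrC e3.
have : cross (spoke 3 u 0) ((1 - t) *: spoke 3 u 0 + t *: spoke 3 u 1) =
       t * (sin (2 * pi / 3%:R) * dot u u).
  by rewrite -(c3 0%N) /cross /= /GRing.scale/=; ring.
have : cross ((1 - t) *: spoke 3 u 0 + t *: spoke 3 u 1) (spoke 3 u 1) =
       (1 - t) * (sin (2 * pi / 3%:R) * dot u u).
  by rewrite -(c3 0%N) /cross /= /GRing.scale/=; ring.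
have crZr (a b : R * R) : cross a (s *: b) = s * cross a b.
  by rewrite /cross /= /GRing.scale/=; ring.
have crZl (a b : R * R) : cross (s *: b) a = s * cross b a.
  by rewrite /cross /= /GRing.scale/=; ring.
have cr0 (a : R * R) : cross a a = 0 by rewrite /cross; ring.
rewrite e crZr crZl.
have : (j %% 3 < 3)%N by rewrite ltn_mod.
case: (j %% 3)%N => [|[|[|//]]] _.
- by rewrite cr0; nra.
- by rewrite cr0; nra.
- have -> : cross (spoke 3 u 0) (spoke 3 u 2) =
            - (sin (2 * pi / 3%:R) * dot u u).
    by rewrite -(c3 0%N) s3 /cross /=; ring.
  by nra.
Qed.

Lemma max_rel_diameter_nonincr (R : realType) (C : set (R * R)) (k l : nat)
    (p x y : R * R) :
  compact C -> inscribed C p x -> inscribed C p y ->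
  center_of_symmetry C k p -> center_of_symmetry C l p ->
  (exists2 z, C z & dot (x - p) (x - p) < dot (z - p) (z - p)) ->
  (0 < k)%N -> (6 <= l)%N || (k == 3) && (l == 5) ->
  max_rel_diameter (pieces C (spokes l p y)) <=
  max_rel_diameter (pieces C (spokes k p x)).
Proof.
move=> kC Cx Cy pk pl far k0 kl.
have xy : dot (x - p) (x - p) = dot (y - p) (y - p).
  have [_ _ _ nx] := Cx; have [_ _ _ ny] := Cy.
  have [bx _] := nx; have [by_ _] := ny; apply/eqP.
  by rewrite eq_le (nearest_dot_le nx by_) (nearest_dot_le ny bx).
have l3 : (3 <= l)%N by move: kl => /orP[|/andP[_ /eqP->]] //; lia.
have r0 := radius_gt0 Cy.
have [clC _ _ _] := Cx.
apply: max_rel_diameter_le.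
  have [z Cz xz] := far; exists z; split=> // /(spokes_dist (ltnW (ltnW l3))).
  by rewrite -xy leNgt xz.
move=> A a b PA Aa Ab.
have [Ca Cb] : C a /\ C b by split; exact: (piece_sub clC PA).
have [j sec] := piece_in_sector l3 Cy pl PA.
have [a1 a2] := sec _ Aa; have [b1 b2] := sec _ Ab.
have e11 : dot (spoke l (y - p) j.+1) (spoke l (y - p) j.+1) =
           dot (spoke l (y - p) j) (spoke l (y - p) j).
  by rewrite !dot_spoke_self.
have e12 : dot (spoke l (y - p) j) (spoke l (y - p) j.+1) =
    cos (2 * pi / l%:R) * dot (spoke l (y - p) j) (spoke l (y - p) j).
  by rewrite dot_spokeS dot_spoke_self.
have c0 : 0 < cross (spoke l (y - p) j) (spoke l (y - p) j.+1).
  by rewrite cross_spokeS mulr_gt0// sin_spoke_gt0.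
have ab : a - b = (a - p) - (b - p) by rewrite opprB addrA subrK.
case/orP: kl => [l6|/andP[/eqP k_3 /eqP l_5]].
  have := narrow_sector_dist e11 e12 (cos_spoke_ge _ l6) c0 a1 a2 b1 b2.
  rewrite -ab le_max => /orP[] h.
    apply: le_trans (center_dist_le k0 kC Cx pk far Ca).
    by rewrite !eucl_distE ler_sqrt// dot_ge0.
  apply: le_trans (center_dist_le k0 kC Cx pk far Cb).
  by rewrite !eucl_distE ler_sqrt// dot_ge0.
subst k l; apply: le_trans (triangle_dist_le kC Cx pk).
rewrite eucl_distE ler_sqrt ?mulr_ge0 ?dot_ge0// xy ab.
rewrite -(dot_spoke_self 5 j (y - p)).
have /andP[c5 c5'] := cos_spoke5 R.
by apply: truncated_sector_dist e11 e12 c5 c5' c0 _ _ _ _ _ _ _ _ _;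
  rewrite ?dot_spoke_self//; apply: (tangent_halfplane_spoke _ _ Cy pl).
Qed.

Theorem lemma3p1 (R : realType) (C : set (R * R)) (kC chiC : nat)
    (ks : seq nat) (P : nat -> set (set (R * R)))
    (C_body : planar_convex_body C)
    (C_multi : multi_rot_symmetric C)
    (C_max : maximal_degree C kC)
    (C_min : minimal_degree C chiC)
    (chiC_ge3 : (3 <= chiC)%N)
    (ks_sorted : sorted ltn ks)
    (ks_divisors : forall d, (d \in ks) = (1 < d)%N && (d %| kC)%N)
    (P_standard : forall k, k \in ks -> standard_partition C k (P k)) :
  sorted (fun a b : R => a >= b) [seq max_rel_diameter (P k) | k <- ks].
Proof.
have [kC' cC _] := C_body.
have clC : closed C.
  by apply: compact_closed => //; exact: pseudometric_hausdorff.
have n2 : ~ rot_symmetric C 2 by move=> /(C_min.2 2%N); lia.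
have odd_ks k : k \in ks -> (2 < k)%N && odd k.
  rewrite ks_divisors => /andP[k1 kk].
  have ok : odd k.
    rewrite -[odd k]negbK -dvdn2; apply/negP => k2; apply: n2.
    have /P_standard[_ [p [x [pC _ _]]]] : 2%N \in ks.
      by rewrite ks_divisors (dvdn_trans k2 kk).
    by split=> //; exists p.
  by rewrite ok andbT; case: k k1 ok {kk} => [|[|[|]]].
apply: (@homo_sorted_in _ _ (mem ks) _ ltn); last exact: ks_sorted; last first.
  by apply/allP.
move=> k l kks lks kl /=.
have /andP[k3 ok] := odd_ks _ kks; have /andP[l3 ol] := odd_ks _ lks.
have [_ [p [x [pC near ->]]]] := P_standard _ kks.
have [_ [q [y [qC neary ->]]]] := P_standard _ lks.
have pq : q = p by apply: (center_unique kC' _ _ qC pC); lia.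
move: qC neary; rewrite pq => qC neary.
have pI : nbhs p C by apply: (center_interior C_body _ pC); lia.
have Cx : inscribed C p x by [].
have Cy : inscribed C p y by [].
apply: (max_rel_diameter_nonincr kC' Cx Cy pC qC).
  exact: (far_point Cx _ n2).
  by lia.
have [//|l6] := leqP 6 l.
have l5 : l = 5%N by lia.
have k_3 : k = 3%N by move: kl; rewrite l5 /=; lia.
by rewrite l5 k_3.
Qed.
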